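(* Let $G_1$ and $G_2$ be finite connected graphs (loops and multiple edges allowed), with no vertex of degree $1$, each of rank two. Then $G_1$ and $G_2$ are isomorphic if and only if $\zeta_{G_1}(u)=\zeta_{G_2}(u)$.
   Context: For a finite connected graph $G$ with vertex set $V$, edge set $E$ and no vertex of degree $1$, its rank is $r=|E|-|V|+1$. Let $\mathcal{A}$ be its adjacency matrix ($\mathcal{A}_{ij}$ = number of edges joining $v_i$ and $v_j$ for $i\neq j$; $\mathcal{A}_{ii}$ = twice the number of loops at $v_i$), and $\mathcal{Q}=D-I$ with $D$ the diagonal matrix of degrees (a loop contributes $2$ to the degree). The reciprocal Ihara zeta function is $\zeta_G(u)^{-1}=(1-u^2)^{r-1}\det(I-\mathcal{A}u+\mathcal{Q}u^2)$. *)

(* Defs.v *)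
From HB Require Import structures.
From mathcomp Require Import all_boot all_order all_algebra fraction.
Set Implicit Arguments. Unset Strict Implicit. Unset Printing Implicit Defensive.
Import Order.TTheory GRing.Theory Num.Theory.
Local Open Scope ring_scope.

(* A finite multigraph (loops and multiple edges allowed) on vertex set 'I_nv.
   mult i j (i <> j) = number of edges joining i and j; mult i i = number of loops at i. *)
Record mgraph := MGraph {
  nv : nat;
  mult : 'I_nv -> 'I_nv -> nat;
  mult_sym : forall i j, mult i j = mult j i }.

Definition adjn (G : mgraph) (i j : 'I_(nv G)) : nat :=
  if i == j then (2 * mult i i)%N else mult i j.

Arguments adjn : clear implicits.
Definition deg (G : mgraph) (i : 'I_(nv G)) : nat := (\sum_(j < nv G) adjn G i j)%N.

Arguments deg : clear implicits.
Definition nedges (G : mgraph) : nat :=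
  (\sum_(i < nv G) \sum_(j < nv G | (i < j)%N) mult i j + \sum_(i < nv G) mult i i)%N.

Definition rank (G : mgraph) : int := (nedges G)%:Z - (nv G)%:Z + 1.

Definition connected (G : mgraph) : Prop :=
  (0 < nv G)%N /\
  forall i j : 'I_(nv G), connect (fun a b => (0 < mult a b)%N) i j.

Definition no_deg1 (G : mgraph) : Prop := forall i, deg G i != 1%N.

Definition ihara_mx (G : mgraph) : 'M[{poly rat}]_(nv G) :=
  \matrix_(i, j) ((i == j)%:R - (adjn G i j)%:R * 'X
                  + (i == j)%:R * ((deg G i)%:R - 1) * 'X^2).

Local Notation tofrac := (@FracField.tofrac _).
Definition ihara_recip (G : mgraph) : {fraction {poly rat}} :=
  (tofrac (1 - 'X^2 : {poly rat})) ^ (rank G - 1) * tofrac (\det (ihara_mx G)).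

Definition ihara_zeta (G : mgraph) : {fraction {poly rat}} := (ihara_recip G)^-1.

Definition isomorphic (G1 G2 : mgraph) : Prop :=
  exists f : 'I_(nv G1) -> 'I_(nv G2),
    bijective f /\ forall i j, mult (f i) (f j) = mult i j.

(* Main.v *)
(* A connected graph of rank two without vertices of degree one is spanned by a
   Hamiltonian path 0, ..., n - 1, to which exactly two edges {0, j} and
   {n - 1, i} are added: for j <= i this is a dumbbell (two cycles joined by a
   path, possibly of length 0), for i < j a theta graph.  Writing N for the
   successor matrix of the path and L = I - u N, the matrix I - A u + Q u^2 is
   L (I + V C V^T) L^T with V of width 4, so its determinant is that of a
   4 x 4 matrix.  With x = u^a, y = u^b, z = u^c for the lengths, the reciprocal
   zeta function is
     (1 - x) (1 - y) ((1 - x) (1 - y) - 4 x y z^2)   for dumbbells,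
     (1 - x y - x z - y z)^2 - 4 (x y z)^2           for theta graphs,
   and low order coefficients recover the lengths. *)
Require Import Defs.
From HB Require Import structures.
From mathcomp Require Import all_boot all_order all_algebra fraction.
From mathcomp Require Import fingroup perm zify ring lra.
Set Implicit Arguments. Unset Strict Implicit. Unset Printing Implicit Defensive.

(** * Edge lists *)

Section EdgeLists.
Variable T : finType.
Implicit Types (l : seq (T * T)) (s p : seq T) (x y a b : T).

(** The pairs stand for unoriented edges. A loop contributes 2, matching the diagonal convention of
    [adjn]. *)
Definition ladj l a b : nat :=
  \sum_(e <- l) ((a == e.1) && (b == e.2) + (a == e.2) && (b == e.1)).

Definition steps s : seq (T * T) := zip s (behead s).

Definition cyc_steps s : seq (T * T) := zip s (rot 1 s).

Lemma ladj_cons e l a b :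
  ladj (e :: l) a b =
  (a == e.1) && (b == e.2) + (a == e.2) && (b == e.1) + ladj l a b.
Proof. by rewrite /ladj big_cons. Qed.

Lemma ladj_sym l a b : ladj l a b = ladj l b a.
Proof. by apply: eq_bigr => e _; rewrite addnC andbC [X in _ + nat_of_bool X]andbC. Qed.

Lemma ladj_diag_even l a : ~~ odd (ladj l a a).
Proof.
elim: l => [|e l IHl]; first by rewrite /ladj big_nil.
by rewrite ladj_cons oddD [X in _ + nat_of_bool X]andbC addnn odd_double.
Qed.

Lemma ladj_perm l l' a b : perm_eq l l' -> ladj l a b = ladj l' a b.
Proof. exact: perm_big. Qed.

Lemma ladj_flip x y l a b : ladj ((x, y) :: l) a b = ladj ((y, x) :: l) a b.
Proof. by rewrite !ladj_cons /= [X in X + _]addnC. Qed.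

Lemma ladj_gt0 l a b : 0 < ladj l a b -> ((a, b) \in l) || ((b, a) \in l).
Proof.
elim: l => [|[x y] l IHl]; first by rewrite /ladj big_nil.
rewrite ladj_cons !inE /= !xpair_eqE.
case: (altP andP) => [//|_]; case: (altP andP) => [[-> ->]|_] /=.
  by rewrite orbT.
rewrite add0n => /IHl; by case/orP => ->; rewrite ?orbT.
Qed.

Lemma sum_ladj l a :
  \sum_b ladj l a b = \sum_(e <- l) ((a == e.1) + (a == e.2)).
Proof.
rewrite exchange_big; apply: eq_bigr => e _; rewrite big_split /=.
have sum1 (c : bool) (z : T) : \sum_b (c && (b == z) : nat) = c.
  case: c => /=; last by rewrite big1.
  by rewrite (bigD1 z) //= eqxx big1 ?addn0 // => b /negPf ->.
by rewrite !sum1.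
Qed.

Lemma total_ladj l : \sum_a \sum_b ladj l a b = 2 * size l.
Proof.
under eq_bigr => a _ do rewrite sum_ladj.
rewrite exchange_big /=.
have sum1 (z : T) : \sum_b (b == z : nat) = 1.
  by rewrite (bigD1 z) //= eqxx big1 ?addn0 // => b /negPf ->.
under eq_bigr => e _ do rewrite big_split /= !sum1.
by rewrite big_const_seq count_predT iter_addn_0.
Qed.

Lemma steps_cons x y p : steps (x :: y :: p) = (x, y) :: steps (y :: p).
Proof. by []. Qed.

Lemma size_steps x p : size (steps (x :: p)) = size p.
Proof. by rewrite size_zip /= minnE; lia. Qed.

Lemma steps_mem s e : e \in steps s -> (e.1 \in s) && (e.2 \in s).
Proof.
elim: s => [|x [|y p] IHs] //; rewrite steps_cons inE.
case/orP => [/eqP -> /=|/IHs /andP[]]; first by rewrite !inE !eqxx orbT.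
by rewrite [_ \in x :: _]inE [_ \in x :: _]inE => -> ->; rewrite !orbT.
Qed.

Lemma steps_sub (r : rel T) s e : sorted r s -> e \in steps s -> r e.1 e.2.
Proof.
elim: s => [|x [|y p] IHs] //; rewrite steps_cons inE /= => /andP[rxy pyp].
by case/orP => [/eqP -> //|/IHs]; apply.
Qed.

Lemma ladj_notin l (S : {pred T}) a b :
  (forall e, e \in l -> (e.1 \in S) && (e.2 \in S)) -> a \notin S ->
  ladj l a b = 0.
Proof.
move=> lS aS; apply/eqP; rewrite -leqn0 leqNgt; apply: contra aS.
by case/ladj_gt0/orP => /lS /andP[].
Qed.

Lemma ladj_steps_le1 s a b : uniq s -> ladj (steps s) a b <= 1.
Proof.
elim: s => [|x [|y p] IHs]; rewrite /ladj ?big_nil // -/(ladj _ a b).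
rewrite cons_uniq => /andP[xyp uyp]; rewrite ladj_cons /=.
have Sx c : ladj (steps (y :: p)) x c = 0.
  by apply: (@ladj_notin _ (mem (y :: p))) => //= e /steps_mem.
have nxy : x != y by apply: contra xyp => /eqP ->; rewrite mem_head.
have [-> | ax] := eqVneq a x.
  by rewrite Sx (negPf nxy) addn0; case: (b == y).
have [-> | bx] := eqVneq b x.
  by rewrite ladj_sym Sx andbT addn0; case: (a == y).
by rewrite andbF; apply: IHs.
Qed.

Lemma deg_steps_head x p :
  uniq (x :: p) -> \sum_b ladj (steps (x :: p)) x b <= 1.
Proof.
rewrite sum_ladj; case: p => [|y p]; first by rewrite big_nil.
rewrite steps_cons big_cons /= eqxx => /andP[xyp uyp].
have nxy : x != y by apply: contra xyp => /eqP ->; rewrite mem_head.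
rewrite (negPf nxy) big_seq big1 // => e /steps_mem /andP[e1 e2].
by case: eqP e1 xyp => [->->|_ _] //; case: eqP e2 => [->->|].
Qed.

Lemma deg_steps_last x p :
  uniq (x :: p) -> \sum_b ladj (steps (x :: p)) (last x p) b <= 1.
Proof.
rewrite sum_ladj.
elim: p x => [|y p IHp] x; first by rewrite big_nil.
rewrite steps_cons big_cons cons_uniq => /andP[xyp uyp].
have nx : last y p == x = false.
  by apply/negbTE; apply: contra xyp => /eqP <-; rewrite mem_last.
rewrite /= nx add0n.
case: p xyp uyp nx IHp => [|z p] xyp uyp nx IHp; first by rewrite /= eqxx big_nil.
have -> : last y (z :: p) == y = false.
  apply/negbTE; move: uyp; rewrite cons_uniq => /andP[yzp _].
  by apply: contra yzp => /= /eqP <-; rewrite mem_last.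
by apply: IHp.
Qed.

Lemma cyc_stepsE x p : cyc_steps (x :: p) = rcons (steps (x :: p)) (last x p, x).
Proof.
rewrite /cyc_steps /steps rot1_cons /=.
have E z : zip (z :: p) (rcons p x) = rcons (zip (z :: p) p) (last z p, x).
  by elim: p z => //= y p IHp z; rewrite -IHp.
exact: E.
Qed.

Lemma zip_rot k s (t : seq T) :
  size s = size t -> zip (rot k s) (rot k t) = rot k (zip s t).
Proof.
move=> st; rewrite /rot zip_cat ?size_drop ?st //; congr (_ ++ _).
  by elim: k s t st => [|k IHk] [|x s] [|y t] //= [st]; rewrite IHk.
by elim: k s t st => [|k IHk] [|x s] [|y t] //= [st]; rewrite IHk.
Qed.

Lemma cyc_steps_rot k s : cyc_steps (rot k s) = rot k (cyc_steps s).
Proof. by rewrite /cyc_steps rot_rot zip_rot ?size_rot. Qed.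

End EdgeLists.

(** * Hamiltonian paths in graphs of rank two *)

Section HamiltonianPath.
Variables (T : finType) (A : T -> T -> nat).
Hypothesis A_sym : forall a b, A a b = A b a.
Hypothesis A_diag : forall a, ~~ odd (A a a).
Hypothesis A_deg : forall a, 2 <= \sum_b A a b.
Hypothesis A_total : \sum_a \sum_b A a b = 2 * #|T| + 2.
Hypothesis A_conn : forall a b, connect (fun a b => 0 < A a b) a b.
Implicit Types (l : seq (T * T)) (s p : seq T) (x y a b : T).

Let e : rel T := fun a b => 0 < A a b.

(** The list is a sub-multigraph of [A], multiplicities included. *)
Definition below l := forall a b, ladj l a b <= A a b.

(** For [x = y] the new loop adds 2 to a diagonal entry. Both diagonals are even, so a strict
    inequality there already leaves a gap of 2. *)
Lemma below_cons l x y :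
  below l -> ladj l x y < A x y -> below ((x, y) :: l).
Proof.
move=> bl lt_xy a b; rewrite ladj_cons /=.
have lt_yx : ladj l y x < A y x by rewrite ladj_sym A_sym.
have [-> | ax] := eqVneq a x; have [-> | bx] := eqVneq b x => /=.
- have [yx | nyx] := eqVneq x y; last by rewrite add0n.
  move: lt_xy; rewrite -yx.
  by have := A_diag x; have := ladj_diag_even l x; lia.
- have [-> | by_] := eqVneq b y; last by rewrite andbF add0n.
  by rewrite andbF addn0.
- by rewrite andbT; have [-> // | ay] := eqVneq a y; apply: bl.
- by rewrite andbF; apply: bl.
Qed.

Lemma below_size l : below l -> 2 * size l <= 2 * #|T| + 2.
Proof.
move=> bl; rewrite -total_ladj -A_total.
by apply: leq_sum => a _; apply: leq_sum.
Qed.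

(** The degree sum leaves room for exactly [#|T|.+1] edges; a strict inequality anywhere would let
    [below_cons] add one more. *)
Lemma below_full l :
  below l -> size l = #|T|.+1 -> forall a b, A a b = ladj l a b.
Proof.
move=> bl sl a b; apply/eqP; rewrite eqn_leq bl andbT leqNgt; apply/negP.
move=> /(below_cons bl)/below_size /=; rewrite sl. move: #|T|; lia.
Qed.

Lemma below_steps s : uniq s -> sorted e s -> below (steps s).
Proof.
move=> us es a b; have := ladj_steps_le1 a b us.
case E: ladj => [//|n] n1; apply: leq_trans n1 _.
have: 0 < ladj (steps s) a b by rewrite E.
by case/ladj_gt0/orP => /(steps_sub es) //=; rewrite /e /= A_sym.
Qed.

Lemma exit_edge s x w :
  x \in s -> w \notin s -> exists a b, [/\ a \in s, b \notin s & 0 < A a b].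
Proof.
move=> xs ws; have /connectP[p + wE] := A_conn x w.
elim: p x xs wE => [|y p IHp] x xs wE /=; first by rewrite wE xs in ws.
case/andP => xy yp; have [ys | ys] := boolP (y \in s); first exact: IHp ys _ _.
by exists x, y.
Qed.

Lemma excess_neighbour l a :
  \sum_b ladj l a b < \sum_b A a b -> exists b, ladj l a b < A a b.
Proof.
move=> lt; apply/existsP; apply: contraLR lt; rewrite negb_exists -leqNgt.
by move/forallP => H; apply: leq_sum => b _; rewrite leqNgt H.
Qed.

(** Suppose a vertex lies outside [s]. Then some edge leaves [s], so the degrees in [s] sum to more
    than [2 * size l], hence to at least [2 * size s + 3]. Each outside vertex adds at least 2, and
    the total exceeds [2 * #|T| + 2]. *)
Lemma spanning l s x :
  uniq s -> x \in s -> below l ->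
  (forall f, f \in l -> (f.1 \in s) && (f.2 \in s)) -> size s < size l ->
  size s = #|T|.
Proof.
move=> us xs bl ls sl; apply/eqP; rewrite eqn_leq.
rewrite -(card_uniqP us) max_card /= leqNgt; apply/negP => lt.
have [w ws] : exists w, w \notin s.
  apply/existsP; rewrite -negb_forall; apply: contraL lt => /forallP sT.
  by rewrite -leqNgt; apply/subset_leq_card/subsetP => w _; apply: sT.
have [a [b [as_ bs ab]]] := exit_edge xs ws.
have inS : \sum_(c in s) \sum_d ladj l c d = 2 * size l.
  rewrite -total_ladj [RHS](bigID (mem s)) /= [X in _ + X]big1 ?addn0 // => c cs.
  by rewrite big1 // => d _; apply: ladj_notin ls cs.
have lt_in : 2 * size l < \sum_(c in s) \sum_d A c d.
  rewrite -inS (bigD1 a) //= [X in _ < X](bigD1 a) //= -addSn leq_add //; last first.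
    by apply: leq_sum => c _; apply: leq_sum.
  rewrite (bigD1 b) //= [X in _ < X](bigD1 b) //= -addSn leq_add //.
    by rewrite ladj_sym (ladj_notin _ ls bs).
  by apply: leq_sum => c _.
have out : 2 * #|predC (mem s)| <= \sum_(c | c \notin s) \sum_d A c d.
  rewrite mulnC -sum_nat_const; apply: leq_sum => c _; exact: A_deg.
have := A_total; rewrite (bigID (mem s)) /=.
have := cardC (mem s); rewrite (card_uniqP us).
move: #|[predC _]| #|T| (size s) (size l) sl out lt_in.
move: (\sum_(c in s) _) (\sum_(c | c \notin s) _); lia.
Qed.

Lemma longest_path x0 : exists x p,
  [/\ uniq (x :: p), path e x p
    & forall y q, uniq (y :: q) -> path e y q -> size q <= size p].
Proof.
pose P m := [exists x, exists t : m.-tuple T, uniq (x :: t) && path e x t].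
have P0 : exists m, P m.
  by exists 0; apply/existsP; exists x0; apply/existsP; exists [tuple].
have ubP m : P m -> m <= #|T|.
  case/existsP => x /existsP[t /andP[/= /andP[_ /card_uniqP ut] _]].
  by rewrite -(size_tuple t) -ut max_card.
case: (ex_maxnP P0 ubP) => m /existsP[x /existsP[t /andP[ut pt]]] maxm.
exists x, t; split=> // y q uq pq; rewrite size_tuple; apply: maxm.
by apply/existsP; exists y; apply/existsP; exists (in_tuple q); rewrite uq.
Qed.

(* A longest path has its ends joined back to it; if these two chords are
   distinct the degree count forbids any further vertex, and if they coincide the path
   closes up to a cycle, which can be reopened at a vertex carrying the
   remaining edge. *)
Lemma hamiltonian_path x0 : exists x p y z,
  [/\ uniq (x :: p), (size p).+1 = #|T|
    & forall a b, A a b = ladj ((last x p, z) :: (x, y) :: steps (x :: p)) a b].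
Proof.
(* The path and two chords form a list with one edge more than [x :: p] has vertices, as [spanning]
   requires. *)
have finish x p y z : uniq (x :: p) -> y \in x :: p -> z \in x :: p ->
    below ((last x p, z) :: (x, y) :: steps (x :: p)) ->
    [/\ uniq (x :: p), (size p).+1 = #|T|
    & forall a b, A a b = ladj ((last x p, z) :: (x, y) :: steps (x :: p)) a b].
  move=> us ys zs bl.
  have sz : (size p).+1 = #|T|.
    apply: (spanning us (mem_head x p) bl); last by rewrite /= size_steps.
    move=> f; rewrite 2!inE => /or3P[/eqP->|/eqP->|/steps_mem //] /=.
      by rewrite mem_last.
    by rewrite mem_head.
  by split=> //; apply: below_full => //=; rewrite size_steps sz.
have [x [p [us es maxp]]] := longest_path x0.
(* Stated for every path of maximal length, since it is applied again to the reopened cycle. *)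
have head_nbr x' p' y : uniq (x' :: p') -> path e x' p' -> size p' = size p ->
    0 < A x' y -> y \in x' :: p'.
  move=> us' es' sz' xy; apply: contraT => ys.
  have := maxp y (x' :: p'); rewrite cons_uniq ys us' /= es' /e A_sym xy sz'.
  by rewrite ltnn; apply.
have last_nbr y : 0 < A (last x p) y -> y \in x :: p.
  move=> xy; apply: contraT => ys.
  have := maxp x (rcons p y); rewrite -rcons_cons rcons_uniq ys us.
  by rewrite rcons_path es /e xy size_rcons ltnn; apply.
have bs : below (steps (x :: p)) by apply: below_steps.
have [y xy] : exists y, ladj (steps (x :: p)) x y < A x y.
  by apply: excess_neighbour; apply: leq_ltn_trans (deg_steps_head us) (A_deg x).
have ys : y \in x :: p by apply: head_nbr => //; apply: leq_ltn_trans xy.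
have bl := below_cons bs xy.
have [yE | ny] := eqVneq y (last x p); last first.
  have nx : last x p != x.
    case: p us ys ny {es maxp head_nbr last_nbr bs xy bl} => [|z p] us ys ny.
      by move: ys ny; rewrite inE => /eqP->; rewrite eqxx.
    by move: us; rewrite cons_uniq => /andP[+ _]; apply: contra => /= /eqP <-;
       rewrite mem_last.
  (* The chord at [x] avoids the last vertex, which therefore has degree at most 1 in the list and a
     further edge in the graph. *)
  have [z lz] : exists z, ladj ((x, y) :: steps (x :: p)) (last x p) z < A (last x p) z.
    apply: excess_neighbour; apply: leq_trans (A_deg _).
    have := deg_steps_last us; rewrite !sum_ladj big_cons /=.
    by rewrite (negPf nx) eq_sym (negPf ny).
  exists x, p, y, z; apply: finish => //; last exact: below_cons.
  by apply: last_nbr; apply: leq_ltn_trans lz.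
subst y.
have bc : below (cyc_steps (x :: p)).
  move=> a b; apply: leq_trans (bl a b).
  by rewrite cyc_stepsE (ladj_perm _ _ (_ : perm_eq _ ((last x p, x) :: steps (x :: p))))
     ?perm_rcons // ladj_flip.
have sz_cyc : size (cyc_steps (x :: p)) = (size p).+1.
  by rewrite cyc_stepsE size_rcons size_steps.
have cyc_mem f : f \in cyc_steps (x :: p) -> (f.1 \in x :: p) && (f.2 \in x :: p).
  rewrite cyc_stepsE mem_rcons inE => /orP[/eqP -> /=|/steps_mem //].
  by rewrite mem_last mem_head.
(* An edge off the cycle with an end on it: an exit edge if the cycle misses a vertex, and otherwise
   the one edge by which the total exceeds the cycle. *)
have [a [b [as_ ab]]] :
    exists a b, a \in x :: p /\ ladj (cyc_steps (x :: p)) a b < A a b.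
  have [/forallP sT | ] := boolP [forall w, w \in x :: p]; last first.
    rewrite negb_forall => /existsP[w ws].
    have [a [b [as_ bs' ab]]] := exit_edge (mem_head x p) ws.
    exists a, b; split=> //.
    by rewrite ladj_sym (ladj_notin _ cyc_mem bs').
  have: \sum_a \sum_b ladj (cyc_steps (x :: p)) a b < \sum_a \sum_b A a b.
    have : #|T| = size (x :: p).
      by rewrite -(card_uniqP us); apply: eq_card => w; rewrite sT.
    by rewrite total_ladj A_total sz_cyc /=; lia.
  move=> lt; have [a /excess_neighbour[b ab]] : exists a,
      \sum_b ladj (cyc_steps (x :: p)) a b < \sum_b A a b.
    apply/existsP; apply: contraLR lt; rewrite negb_exists -leqNgt.
    by move/forallP => H; apply: leq_sum => a _; rewrite leqNgt H.
  by exists a, b; split=> //; apply: sT.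
(* Reopened at [a], the cycle is a path from [a] with chord back to [a], and [{a, b}] is the second
   chord. *)
case: (rot_to as_) => i q rotE.
have uq : uniq (a :: q) by rewrite -rotE rot_uniq.
have szq : size q = size p by have := size_rot i (x :: p); rewrite rotE => -[].
have eq_ : path e a q.
  have : path.cycle e (x :: p).
    rewrite /= rcons_path es /e A_sym; exact: leq_ltn_trans xy.
  by rewrite -(rot_cycle i) rotE /= rcons_path => /andP[].
have permc : perm_eq ((last a q, a) :: steps (a :: q)) (cyc_steps (x :: p)).
  by rewrite -perm_rcons -cyc_stepsE -rotE cyc_steps_rot perm_rot.
exists a, q, b, a; apply: finish => //.
- by apply: head_nbr => //; apply: leq_ltn_trans ab.
- exact: mem_head.
move=> c d; apply: leq_trans (below_cons bc ab c d).
rewrite (ladj_perm _ _ (_ : perm_eq _ ((a, b) :: (last a q, a) :: steps (a :: q)))).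
  by rewrite ladj_cons [X in _ <= X]ladj_cons (ladj_perm _ _ permc).
by rewrite (perm_catCA [:: _] [:: _]).
Qed.

End HamiltonianPath.

(** * The normal form *)

Lemma ladj_steps_nth (T : finType) (x0 : T) s k m :
  uniq s -> k < size s -> m < size s ->
  ladj (steps s) (nth x0 s k) (nth x0 s m) = (k.+1 == m) + (m.+1 == k).
Proof.
elim: s k m => [|x [|y p] IHs] // k m.
  by case: k m => [|k] [|m] // _ _ _; rewrite /ladj big_nil.
rewrite cons_uniq => /andP[xyp uyp] hk hm; rewrite steps_cons ladj_cons /=.
have Sx c : ladj (steps (y :: p)) x c = 0.
  by apply: (@ladj_notin _ _ (mem (y :: p))) => //= e /steps_mem.
have nx q : q < size (y :: p) -> nth x0 (y :: p) q == x = false.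
  by move=> hq; apply: contraNF xyp => /eqP <-; apply: mem_nth.
have ny q : q < size (y :: p) -> (nth x0 (y :: p) q == y) = (q == 0).
  by move=> hq; rewrite -[X in _ == X]/(nth x0 (y :: p) 0) nth_uniq.
have nxy : x == y = false by rewrite -[y]/(nth x0 (y :: p) 0) eq_sym nx.
case: k m hk hm => [|k] [|m] hk hm; rewrite ?[nth _ (x :: _) _]/=.
- by rewrite nxy eqxx Sx.
- by rewrite Sx nx // ny // eqxx andbF !addn0; case: m {hm}.
- by rewrite ladj_sym Sx nx // ny // eqxx andbT addn0; case: k {hk}.
- by rewrite !nx // andbF IHs // !eqSS.
Qed.

(** The summands follow the list in [hamiltonian_path]: chord at the last vertex, chord at vertex 0,
    path steps. Loops count twice, which [hgraph] halves. *)
Definition hadj n i j (x y : nat) : nat :=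
  (x == n.-1) && (y == i) + (x == i) && (y == n.-1)
  + ((x == 0) && (y == j) + (x == j) && (y == 0)
     + ((x.+1 == y) + (y.+1 == x))).

Lemma hadj_sym n i j x y : hadj n i j x y = hadj n i j y x.
Proof.
rewrite /hadj; congr (_ + (_ + _)); last exact: addnC.
  by rewrite addnC andbC [X in _ + nat_of_bool X]andbC.
by rewrite addnC andbC [X in _ + nat_of_bool X]andbC.
Qed.

Lemma hadj_diag_even n i j x : ~~ odd (hadj n i j x x).
Proof. by rewrite /hadj !oddD !oddb andbC [X in _ (+) (X (+) _ (+) _)]andbC !addbb. Qed.

Lemma hgraph_subproof n i j (x y : 'I_n) :
  (if x == y then (hadj n i j x x)./2 else hadj n i j x y) =
  (if y == x then (hadj n i j y y)./2 else hadj n i j y x).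
Proof. by rewrite eq_sym hadj_sym; case: eqP => [->|]. Qed.

(* The path 0, ..., n - 1 with the two further edges {0, j} and {n - 1, i}. *)
Definition hgraph n i j : mgraph := MGraph (@hgraph_subproof n i j).

Lemma adjn_hgraph n i j (x y : 'I_n) : adjn (hgraph n i j) x y = hadj n i j x y.
Proof.
rewrite /adjn /= eqxx; case: eqP => [->|//].
by rewrite mul2n halfK (negPf (hadj_diag_even _ _ _ _)) subn0.
Qed.

Lemma adjn_sym G x y : adjn G x y = adjn G y x.
Proof. by rewrite /adjn eq_sym mult_sym; case: eqP => [->|]. Qed.

Lemma adjn_gt0 G x y : (0 < adjn G x y) = (0 < mult x y).
Proof. by rewrite /adjn; case: eqP => [->|]; rewrite ?muln_gt0. Qed.

Lemma isomorphic_adjn G1 G2 (f : 'I_(nv G1) -> 'I_(nv G2)) :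
  bijective f -> (forall x y, adjn G2 (f x) (f y) = adjn G1 x y) ->
  isomorphic G1 G2.
Proof.
move=> bij_f adj_f; exists f; split=> // x y.
have := adj_f x y; rewrite /adjn (inj_eq (bij_inj bij_f)); case: eqP => [->|//].
by move/eqP; rewrite eqn_mul2l => /eqP.
Qed.

Lemma isomorphic_trans G1 G2 G3 :
  isomorphic G1 G2 -> isomorphic G2 G3 -> isomorphic G1 G3.
Proof.
move=> [f [bij_f mf]] [g [bij_g mg]]; exists (g \o f); split.
  exact: bij_comp.
by move=> x y; rewrite /= mg mf.
Qed.

Lemma isomorphic_sym G1 G2 : isomorphic G1 G2 -> isomorphic G2 G1.
Proof.
move=> [f [bij_f mf]]; have [g fK gK] := bij_f.
by exists g; split=> [|x y]; [exists f | rewrite -mf !gK].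
Qed.

Lemma sum_deg G : \sum_x deg G x = 2 * nedges G.
Proof.
have degE x : deg G x =
    2 * mult x x + (\sum_(y < nv G | x < y) mult x y + \sum_(y < nv G | y < x) mult x y).
  rewrite /deg (bigD1 x) //= /adjn eqxx; congr (_ + _).
  rewrite (bigID (fun y : 'I_ _ => x < y)) /=; congr (_ + _).
    apply: eq_big => y; first by rewrite -val_eqE; case: ltngtP.
    by rewrite eq_sym => /andP[/negPf ->].
  apply: eq_big => y; first by rewrite -val_eqE; case: ltngtP.
  by rewrite eq_sym => /andP[/negPf ->].
under eq_bigr => x _ do rewrite degE.
rewrite big_split /= -[X in X + _](big_distrr 2) /= big_split /= /nedges mulnDr addnC.
congr (_ + _).
rewrite mul2n -addnn; congr (_ + _).
rewrite (exchange_big_dep xpredT) //=; apply: eq_bigr => x _.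
by apply: eq_bigr => y _; apply: mult_sym.
Qed.

Lemma rank2_hgraph G :
  connected G -> no_deg1 G -> rank G = 2%:Z%R ->
  exists i j, [/\ i < nv G, j < nv G & isomorphic (hgraph (nv G) i j) G].
Proof.
move=> [n0 conn] deg1 rk.
have edges : nedges G = (nv G).+1 by move: rk; rewrite /rank; lia.
have tot : \sum_x \sum_y adjn G x y = 2 * #|'I_(nv G)| + 2.
  by rewrite card_ord (sum_deg G : \sum_x \sum_y adjn G x y = _) edges mulnS addnC.
have deg2 x : 2 <= \sum_y adjn G x y.
  have := deg1 x; rewrite -/(deg G x); case E: (deg G x) => [|[|d]] // _.
  (* A vertex of degree 0 would be the only vertex by connectivity, and the total degree would
     vanish. *)
  have nbr y : mult x y = 0.
    apply/eqP; rewrite -leqn0 leqNgt -adjn_gt0 -leqNgt -E.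
    by rewrite /deg (bigD1 y) //= leq_addr.
  have all_x y : y = x.
    have /connectP[[|z p] /= pth ->] // := conn x y.
    by rewrite nbr in pth.
  have := tot; rewrite (bigD1 x) //= [X in X + _](E : \sum_y adjn G x y = 0).
  rewrite big1 => [|y]; last by rewrite (all_x y) eqxx.
  by rewrite card_ord addn2.
have conn' x y : connect (fun a b => 0 < adjn G a b) x y.
  rewrite (eq_connect (e' := fun a b => 0 < mult a b)) // => a b.
  exact: adjn_gt0.
have even x : ~~ odd (adjn G x x) by rewrite /adjn eqxx oddM.
have [x [p [y [z [us szp adjE]]]]] :=
  hamiltonian_path (@adjn_sym G) even deg2 tot conn' (Ordinal n0).
rewrite card_ord in szp.
set s := x :: p in us adjE *.
have szs : size s = nv G by [].
have s_all w : w \in s.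
  have /subset_cardP : #|s| = #|'I_(nv G)| by rewrite (card_uniqP us) szs card_ord.
  by move=> /(_ (subset_predT _)) ->.
have idx_lt w : index w s < nv G by have := s_all w; rewrite -index_mem szs.
exists (index z s), (index y s); split; try exact: idx_lt.
(* Vertices are numbered by their position along the Hamiltonian path. *)
pose f (k : 'I_(nv G)) := nth x s k.
have inj_f : injective f.
  by move=> k m /eqP; rewrite /f nth_uniq ?szs // => /eqP/val_inj.
apply: (@isomorphic_adjn (hgraph _ _ _) G f); first exact: injF_bij.
move=> k m; rewrite adjn_hgraph adjE !ladj_cons /= ladj_steps_nth ?szs //.
have nthE (q : 'I_(nv G)) w : (f q == w) = (val q == index w s).
  by rewrite -{1}(nth_index x (s_all w)) nth_uniq ?szs.
have idx0 : index x s = 0 by rewrite /= eqxx.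
have idxn : index (last x p) s = (nv G).-1 by rewrite (index_last us) -[in RHS]szp.
by rewrite !nthE idx0 idxn.
Qed.

(** Reversing the whole path exchanges the roles of the two chords. *)
Lemma isomorphic_hgraph_rev n i j : i < n -> j < n ->
  isomorphic (hgraph n i j) (hgraph n (n.-1 - j) (n.-1 - i)).
Proof.
move=> hi hj; apply: (@isomorphic_adjn (hgraph _ _ _) (hgraph _ _ _) (@rev_ord n)).
  exact: (Bijective (@rev_ordK n) (@rev_ordK n)).
move=> x y; rewrite !adjn_hgraph /hadj /=.
have top (z : 'I_n) : (n - z.+1 == n.-1) = (z == 0 :> nat) by have := ltn_ord z; lia.
have bot (z : 'I_n) : (n - z.+1 == 0) = (z == n.-1 :> nat) by have := ltn_ord z; lia.
have mid k (z : 'I_n) : k < n -> (n - z.+1 == n.-1 - k) = (z == k :> nat).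
  by have := ltn_ord z; lia.
have nxt (z t : 'I_n) : ((n - z.+1).+1 == n - t.+1) = (t.+1 == z).
  by have := ltn_ord z; have := ltn_ord t; lia.
by rewrite !top !bot !mid // !nxt addnCA; congr (_ + (_ + _)); exact: addnC.
Qed.

(** Reverse only the vertices below [j]: the chord [{0, j}] and the path step [{j - 1, j}] change
    places, and the other chord moves from [i] to [j - 1 - i]. *)
Lemma isomorphic_hgraph_prefix n i j : i < j -> j < n ->
  isomorphic (hgraph n i j) (hgraph n (j.-1 - i) j).
Proof.
move=> ij jn.
pose g x := if x < j then j.-1 - x else x.
have gn (x : 'I_n) : g x < n by rewrite /g; have := ltn_ord x; case: ifP; lia.
have gK : involutive (fun x => Ordinal (gn x)).
  by move=> x; apply: val_inj; rewrite /= /g; case: (ltnP x j) => /= hx; case: ltnP; lia.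
apply: (@isomorphic_adjn (hgraph _ _ _) (hgraph _ _ _) (fun x => Ordinal (gn x))).
  exact: inv_bij.
have mixed (x y : 'I_n) : x < j -> j <= y ->
    hadj n (j.-1 - i) j (g x) (g y) = hadj n i j x y.
  move=> hx hy; rewrite /g hx ltnNge hy /= /hadj.
  have -> : (j.-1 - x == n.-1) = false by lia.
  have -> : (j.-1 - x == j.-1 - i) = (x == i :> nat) by lia.
  have -> : (j.-1 - x == j) = false by lia.
  have -> : ((j.-1 - x).+1 == y) = (x == 0 :> nat) && (y == j :> nat) by lia.
  have -> : (y.+1 == j.-1 - x) = false by lia.
  have -> : (x == n.-1 :> nat) = false by lia.
  have -> : (x == j :> nat) = false by lia.
  have -> : (y.+1 == x) = false by lia.
  have -> : (x.+1 == y) = (j.-1 - x == 0) && (y == j :> nat) by lia.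
  by rewrite !andFb !addn0 !add0n [X in _ = _ + X]addnC.
move=> x y; rewrite !adjn_hgraph -[nat_of_ord (Ordinal _)]/(g x)
  -[nat_of_ord (Ordinal _)]/(g y).
have [hx | hx] := ltnP x j; have [hy | hy] := ltnP y j.
- rewrite /g hx hy /hadj.
  have -> : (j.-1 - x == n.-1) = false by lia.
  have -> : (j.-1 - y == n.-1) = false by lia.
  have -> : (j.-1 - x == j) = false by lia.
  have -> : (j.-1 - y == j) = false by lia.
  have -> : (x == n.-1 :> nat) = false by lia.
  have -> : (y == n.-1 :> nat) = false by lia.
  have -> : (x == j :> nat) = false by lia.
  have -> : (y == j :> nat) = false by lia.
  have -> : ((j.-1 - x).+1 == j.-1 - y) = (y.+1 == x) by lia.
  have -> : ((j.-1 - y).+1 == j.-1 - x) = (x.+1 == y) by lia.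
  by rewrite !andbF; congr (_ + (_ + _)); exact: addnC.
- exact: mixed.
- by rewrite hadj_sym mixed // hadj_sym.
rewrite /g ltnNge hx ltnNge hy /= /hadj.
have zk k (z : 'I_n) : j <= z -> k < j -> (z == k :> nat) = false by lia.
by rewrite !(zk i) ?(zk 0) ?(zk (j.-1 - i)) //; lia.
Qed.

Import GRing.Theory Num.Theory.
Local Open Scope ring_scope.

(** * Isomorphism invariance of the determinant *)

Lemma det_ihara_isomorphic G1 G2 :
  isomorphic G1 G2 -> \det (ihara_mx G1) = \det (ihara_mx G2).
Proof.
case=> f [bij_f mf].
have adjf x y : adjn G2 (f x) (f y) = adjn G1 x y.
  by rewrite /adjn (inj_eq (bij_inj bij_f)) !mf.
have degf x : deg G2 (f x) = deg G1 x.
  rewrite /deg (reindex f); last by apply: onW_bij.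
  by apply: eq_bigr => y _.
have nvE : nv G1 = nv G2.
  by have := bij_eq_card bij_f; rewrite !card_ord.
have EM x y : ihara_mx G1 x y = ihara_mx G2 (f x) (f y).
  by rewrite !mxE adjf degf (inj_eq (bij_inj bij_f)).
(* The two sizes are only provably equal; generalising the matrices first allows the substitution,
   after which the matrices are conjugate by a permutation matrix. *)
move: (ihara_mx G1) (ihara_mx G2) EM; clear -nvE bij_f.
move: (nv G1) (nv G2) nvE f bij_f => n m nm; subst m => f bij_f M1 M2 EM.
pose s : 'S_n := perm (bij_inj bij_f).
have -> : M1 = perm_mx s *m M2 *m perm_mx s^-1%g.
  rewrite -row_permE -col_permE; apply/matrixP => x y.
  by rewrite EM !mxE !permE.
rewrite !det_mulmx mulrAC -det_mulmx -perm_mxM mulgV perm_mx1 det1 mul1r //.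
Qed.

(** * The determinant of the normal form *)

(** Laplace expansion along the first two rows, by complementary 2 x 2 minors. *)
Lemma det_mx44 (R : comNzRingType) (f : nat -> nat -> R) :
  \det (\matrix_(a < 4, b < 4) f a b) =
    (f 0 0 * f 1 1 - f 0 1 * f 1 0) * (f 2 2 * f 3 3 - f 2 3 * f 3 2)
  - (f 0 0 * f 1 2 - f 0 2 * f 1 0) * (f 2 1 * f 3 3 - f 2 3 * f 3 1)
  + (f 0 0 * f 1 3 - f 0 3 * f 1 0) * (f 2 1 * f 3 2 - f 2 2 * f 3 1)
  + (f 0 1 * f 1 2 - f 0 2 * f 1 1) * (f 2 0 * f 3 3 - f 2 3 * f 3 0)
  - (f 0 1 * f 1 3 - f 0 3 * f 1 1) * (f 2 0 * f 3 2 - f 2 2 * f 3 0)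
  + (f 0 2 * f 1 3 - f 0 3 * f 1 2) * (f 2 0 * f 3 1 - f 2 1 * f 3 0).
Proof.
rewrite !(expand_det_row _ ord0) !big_ord_recl !big_ord0.
rewrite /cofactor !(expand_det_row _ ord0) !big_ord_recl !big_ord0.
rewrite /cofactor !(expand_det_row _ ord0) !big_ord_recl !big_ord0.
rewrite /cofactor !det_mx11 !mxE /=.
rewrite /bump /=.
ring.
Qed.

(** Two block matrices multiplied in either order give block triangular products, whose determinants
    are the two sides. *)
Lemma sylvester_det (R : comNzRingType) m n (A : 'M[R]_(m, n)) (B : 'M[R]_(n, m)) :
  \det (1%:M + A *m B) = \det (1%:M + B *m A).
Proof.
have E1 : block_mx 1%:M A 0 1%:M *m block_mx 1%:M (- A) B 1%:M
    = block_mx (1%:M + A *m B) 0 B 1%:M.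
  by rewrite mulmx_block !mul1mx !mulmx1 !mul0mx !add0r addNr.
have E2 : block_mx 1%:M (- A) B 1%:M *m block_mx 1%:M A 0 1%:M
    = block_mx 1%:M 0 B (1%:M + B *m A).
  by rewrite mulmx_block !mul1mx !mulmx1 !mulmx0 !addr0 addrN [B *m A + _]addrC.
have := congr1 determinant E1; rewrite det_mulmx mulrC -det_mulmx E2.
by rewrite !det_lblock !det1 mul1r mulr1.
Qed.

Section HgraphDeterminant.
Variables (F : fieldType) (u : F) (n i j : nat).
Hypotheses (u2_neq1 : 1 - u ^+ 2 != 0) (n_gt0 : (0 < n)%N)
  (lt_in : (i < n)%N) (lt_jn : (j < n)%N).

(** The Ihara matrix of [hgraph n i j] at a field element [u], with degrees in the form given by
    [deg_hgraph]. *)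
Definition hgraph_mx : 'M[F]_n :=
  \matrix_(x, y) ((x == y)%:R - (hadj n i j x y)%:R * u
    + (x == y)%:R * ((2 + (x == j :> nat) + (x == i :> nat))%:R - 1) * u ^+ 2).

Definition ends (a : nat) : nat := nth 0 [:: 0; j; i; n.-1]%N a.

(** Column [p] of the inverse of [L] below. The indicator guards against truncated subtraction. *)
Definition geom (p x : nat) : F := (x <= p)%N%:R * u ^+ (p - x).

Definition gram (p q : nat) : F := \sum_(x < n) geom p x * geom q x.

(* The entries of I + C (V^T V), with C and V as below. *)
Definition small_entry (a b : nat) : F :=
  let g c d := gram (ends c) (ends d) in
  (a == b)%:R +
  nth 0 [:: - u * g 1 b; - u * g 0 b + u ^+ 2 * g 1 b;
            u ^+ 2 * g 2 b - u * g 3 b; - u * g 2 b + u ^+ 2 * g 3 b] a.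

Lemma sum_delta (f : nat -> F) (k : nat) :
  \sum_(y < n) (k == y :> nat)%:R * f y = (k < n)%N%:R * f k.
Proof.
have [lt_kn | le_nk] := ltnP k n.
  rewrite (bigD1 (Ordinal lt_kn)) //= eqxx big1 ?addr0 // => y.
  by rewrite eq_sym -val_eqE => /negPf ->; rewrite mul0r.
rewrite mul0r big1 // => y _.
by rewrite gtn_eqF ?mul0r //; apply: leq_trans le_nk.
Qed.

Let L : 'M[F]_n := \matrix_(x, y) ((x == y :> nat)%:R - u * (x.+1 == y)%:R).
Let V : 'M[F]_(n, 4) := \matrix_(x, a) geom (ends a) x.
Let U : 'M[F]_(n, 4) := \matrix_(x, a) (x == ends a :> nat)%:R.
(* L L^T exceeds the matrix of the bare path by u^2 at the entry (0, 0), which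
   already accounts for the contribution of the edge {0, j} there. *)
Let C : 'M[F]_4 := \matrix_(a, b) nth 0 (nth [::]
  [:: [:: 0; - u; 0; 0]; [:: - u; u ^+ 2; 0; 0];
      [:: 0; 0; u ^+ 2; - u]; [:: 0; 0; - u; u ^+ 2]] a) b.

Lemma shift_geom : L *m V = U.
Proof.
apply/matrixP => x a; rewrite !mxE.
have lt_an : (ends a < n)%N by case: a => [[|[|[|[|//]]]] ?] //=; rewrite /ends /= ?prednK.
rewrite (eq_bigr (fun y : 'I_n => (x == y :> nat)%:R * geom (ends a) y
    - u * ((x.+1 == y)%:R * geom (ends a) y))); last first.
  by move=> y _; rewrite !mxE; ring.
rewrite sumrB -mulr_sumr (sum_delta (geom (ends a))) (sum_delta (geom (ends a))).
rewrite ltn_ord mul1r /geom; case: (ltngtP x (ends a)) => [lt_xa | lt_ax | ->].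
- by rewrite (leq_ltn_trans lt_xa lt_an) !mul1r -exprS -subnSK // subrr.
- by rewrite !mul0r mulr0 mulr0 subr0.
- by rewrite subnn expr0 mul0r !mulr0 subr0 mulr1.
Qed.

(** Since [L *m V = U], the right side is [L *m L^T + U *m C *m U^T]: the path plus a correction
    supported on the chord ends. *)
Lemma hgraph_mxE : hgraph_mx = L *m (1%:M + V *m (C *m V^T)) *m L^T.
Proof.
rewrite mulmxDr mulmx1 mulmxDl !mulmxA shift_geom -mulmxA -trmx_mul shift_geom.
apply/matrixP => x y; rewrite !mxE.
rewrite (eq_bigr (fun k : 'I_n => (x == k :> nat)%:R * (y == k :> nat)%:R
   - u * ((x == k :> nat)%:R * (y.+1 == k)%:R)
   - u * ((x.+1 == k)%:R * (y == k :> nat)%:R)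
   + u ^+ 2 * ((x.+1 == k)%:R * (y.+1 == k)%:R))); last first.
  by move=> k _; rewrite !mxE; ring.
rewrite big_split !sumrB /= -!mulr_sumr.
rewrite (sum_delta (fun k => (y == k :> nat)%:R)) (sum_delta (fun k => (y.+1 == k)%:R)).
rewrite (sum_delta (fun k => (y == k :> nat)%:R)) (sum_delta (fun k => (y.+1 == k)%:R)).
under eq_bigr => a _ do rewrite !mxE !big_ord_recl big_ord0 !mxE.
rewrite !big_ord_recl big_ord0 /= /ends /=.
have yx : (y == x :> nat) = (x == y) by rewrite eq_sym.
have top (z : 'I_n) : (z.+1 < n)%N = ~~ (z == n.-1 :> nat) by have := ltn_ord z; lia.
have -> : (x.+1 < n)%N%:R * (y == x.+1 :> nat)%:R = (x.+1 == y)%:R :> F.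
  have := ltn_ord y; case: (x.+1 =P y) => [<- ->|/eqP]; first by rewrite eqxx mulr1.
  by rewrite eq_sym mulrC => /negPf -> _; rewrite mul0r.
rewrite ltn_ord eqSS yx top /hadj !natrD.
(* Diagonal entries of [C] and the missing successor of [n - 1] produce such products; with these
   relations the claim is a polynomial identity in the indicators. *)
have diag c : (x == c :> nat)%:R * (y == c :> nat)%:R = (x == y)%:R * (x == c :> nat)%:R :> F.
  rewrite -!natrM !mulnb; congr (nat_of_bool _)%:R.
  have [-> | nxy] := eqVneq x y; first by rewrite andbb.
  by apply: contraNF nxy => /andP[/eqP xc /eqP yc]; apply/eqP/val_inj; rewrite /= xc.
rewrite -!mulnb !natrM.
have -> : (~~ (x == n.-1 :> nat))%:R = 1 - (x == n.-1 :> nat)%:R :> F.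
  by case: eqP => _; rewrite ?subrr ?subr0.
have := diag n.-1; have := diag i; have := diag j.
move: (x == y)%:R (x == 0%N :> nat)%:R (y == 0%N :> nat)%:R => d x0 y0.
move: (x == n.-1 :> nat)%:R (y == n.-1 :> nat)%:R (x == i :> nat)%:R => xn yn xi.
move: (y == i :> nat)%:R (x == j :> nat)%:R (y == j :> nat)%:R => yi xj yj.
move=> Ej Ei En.
transitivity (d * (1 + u ^+ 2) - u * ((y.+1 == x)%:R + (x.+1 == y)%:R)
  - u * (x0 * yj + xj * y0 + xi * yn + xn * yi) + u ^+ 2 * (d * xj + d * xi)).
  by ring.
by rewrite -Ej -Ei -[d]mulr1 /=; ring: En.
Qed.

(** [L] is unitriangular, and Sylvester's identity passes from size n to size 4. *)
Lemma det_hgraph_mx : \det hgraph_mx = \det (\matrix_(a < 4, b < 4) small_entry a b).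
Proof.
have detL : \det L = 1.
  rewrite -det_tr det_trig; last first.
    apply/is_trig_mxP => x y lt_xy; rewrite !mxE (gtn_eqF lt_xy) gtn_eqF ?mulr0 ?subr0 //.
    exact: ltnW.
  by rewrite big1 // => x _; rewrite !mxE eqxx gtn_eqF // mulr0 subr0.
rewrite hgraph_mxE !det_mulmx det_tr detL mul1r mulr1 sylvester_det -mulmxA.
congr (\det _); apply/matrixP => a b.
rewrite [LHS]mxE [RHS]mxE [X in X + _]mxE [X in _ + X]mxE /small_entry; congr (_ + _).
have gramE c : (V^T *m V) c b = gram (ends c) (ends b).
  by rewrite !mxE; apply: eq_bigr => x _; rewrite !mxE.
under eq_bigr => c _ do rewrite gramE [C _ _]mxE.
rewrite !big_ord_recl big_ord0 /=.
by case: a => [[|[|[|[|//]]]] ?] /=; ring.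
Qed.

Lemma gram_sym p q : gram p q = gram q p.
Proof. by apply: eq_bigr => x _; rewrite mulrC. Qed.

(** Only indices up to [p] contribute, leaving [u ^+ d] times a geometric sum of ratio [u ^+ 2]. *)
Lemma gram_shift p d : (p + d < n)%N ->
  gram p (p + d) = u ^+ d * ((1 - u ^+ 2 * (u ^+ p) ^+ 2) / (1 - u ^+ 2)).
Proof.
move=> lt_pdn; have lt_pn : (p < n)%N by apply: leq_ltn_trans lt_pdn; apply: leq_addr.
have -> : gram p (p + d) = \sum_(0 <= k < p.+1) u ^+ d * (u ^+ 2) ^+ (p - k).
  rewrite /gram -(big_mkord xpredT (fun x => geom p x * geom (p + d) x)).
  have tail : \sum_(p.+1 <= x < n) geom p x * geom (p + d) x = 0.
    rewrite big_nat_cond big1 // => x /andP[/andP[lt_px _] _].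
    by rewrite /geom leqNgt lt_px !mul0r.
  rewrite (big_cat_nat (n := p.+1)) //= tail addr0.
  apply: eq_big_nat => x; rewrite ltnS => /andP[_ le_xp].
  rewrite /geom le_xp (leq_trans le_xp (leq_addr _ _)) !mul1r addnC -addnBA //.
  by rewrite exprD -exprM mul2n -addnn exprD; ring.
rewrite -mulr_sumr; congr (_ * _); apply: (canRL (mulfK u2_neq1)).
rewrite big_nat_rev /= add0n big_mkord.
rewrite (eq_bigr (fun k : 'I_p.+1 => (u ^+ 2) ^+ k)); last first.
  by move=> k _; rewrite subSS subKn // -ltnS.
have := subrX1 (u ^+ 2) p.+1; rewrite exprS -!exprM mulnC exprM => E.
by rewrite -[RHS]opprB E; ring.
Qed.

End HgraphDeterminant.

(** The chords close cycles of lengths [a.+1] and [b.+1], joined by a path of length [c]. Once the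
    Gram entries are in closed form, this is a rational identity in [u] and its powers [u ^+ a],
    [u ^+ b], [u ^+ c]. *)
Lemma det_hgraph_mx_dumbbell (F : fieldType) (u : F) a b c : 1 - u ^+ 2 != 0 ->
  (1 - u ^+ 2) * \det (hgraph_mx u (a + c + b).+1 (a + c) a) =
  (1 - u ^+ a.+1) * (1 - u ^+ b.+1) * ((1 - u ^+ a.+1) * (1 - u ^+ b.+1)
     - 4 * u ^+ a.+1 * u ^+ b.+1 * u ^+ c ^+ 2).
Proof.
move=> q0; set n := (a + c + b).+1.
have [ltn lta ltac] : [/\ (0 < n)%N, (a < n)%N & (a + c < n)%N] by split; rewrite /n; lia.
rewrite det_hgraph_mx // det_mx44 /small_entry /ends /=.
rewrite !(gram_sym u n (a + c + b)) !(gram_sym u n (a + c) a) !(gram_sym u n _ 0).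
have G p d q : (p + d)%N = q -> (q < n)%N ->
    gram u n p q = u ^+ d * ((1 - u ^+ 2 * (u ^+ p) ^+ 2) / (1 - u ^+ 2)).
  by move=> <-; apply: gram_shift.
rewrite !(G 0 0 _ erefl) ?(G 0 a _ erefl) ?(G 0 (a + c)%N _ erefl)
  ?(G 0 (a + c + b)%N _ erefl) //.
rewrite (G a 0 a) ?(G a c (a + c)%N) ?(G a (c + b)%N (a + c + b)%N) ?addn0 ?addnA //.
rewrite (G (a + c) 0 (a + c))%N ?(G (a + c) b (a + c + b))%N ?addn0 //.
rewrite (G (a + c + b) 0 (a + c + b))%N ?addn0 //.
rewrite !expr0 !exprS !exprD.
move: (u ^+ a) (u ^+ b) (u ^+ c) => x y z.
by field.
Qed.

(** For positive [c] the branch vertices are [a] and [a + c]: the arcs through the chords have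
    lengths [a.+1] and [b.+1], the middle one [c]. *)
Lemma det_hgraph_mx_theta (F : fieldType) (u : F) a b c : 1 - u ^+ 2 != 0 ->
  (1 - u ^+ 2) * \det (hgraph_mx u (a + c + b).+1 a (a + c)) =
  (1 - u ^+ a.+1 * u ^+ c - u ^+ a.+1 * u ^+ b.+1 - u ^+ c * u ^+ b.+1) ^+ 2
  - 4 * (u ^+ a.+1 * u ^+ b.+1 * u ^+ c) ^+ 2.
Proof.
move=> q0; set n := (a + c + b).+1.
have [ltn lta ltac] : [/\ (0 < n)%N, (a < n)%N & (a + c < n)%N] by split; rewrite /n; lia.
rewrite det_hgraph_mx // det_mx44 /small_entry /ends /=.
rewrite !(gram_sym u n (a + c + b)) !(gram_sym u n (a + c) a) !(gram_sym u n _ 0).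
have G p d q : (p + d)%N = q -> (q < n)%N ->
    gram u n p q = u ^+ d * ((1 - u ^+ 2 * (u ^+ p) ^+ 2) / (1 - u ^+ 2)).
  by move=> <-; apply: gram_shift.
rewrite !(G 0 0 _ erefl) ?(G 0 a _ erefl) ?(G 0 (a + c)%N _ erefl)
  ?(G 0 (a + c + b)%N _ erefl) //.
rewrite (G a 0 a) ?(G a c (a + c)%N) ?(G a (c + b)%N (a + c + b)%N) ?addn0 ?addnA //.
rewrite (G (a + c) 0 (a + c))%N ?(G (a + c) b (a + c + b))%N ?addn0 //.
rewrite (G (a + c + b) 0 (a + c + b))%N ?addn0 //.
rewrite !expr0 !exprS !exprD.
move: (u ^+ a) (u ^+ b) (u ^+ c) => x y z.
by field.
Qed.

Lemma deg_hgraph n i j (x : 'I_n) : (i < n)%N -> (j < n)%N ->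
  deg (hgraph n i j) x = (2 + (x == j :> nat) + (x == i :> nat))%N.
Proof.
move=> lt_in lt_jn; rewrite /deg (eq_bigr (fun y : 'I_n => hadj n i j x y)); last first.
  by move=> y _; apply: adjn_hgraph.
rewrite /hadj !big_split /=.
have sum1 (d : bool) (k : nat) : (\sum_(y < n) (d && (y == k :> nat)) = d && (k < n))%N.
  case: d => /=; last by rewrite big1.
  have [lt_kn | le_nk] := ltnP k n.
    by rewrite (bigD1 (Ordinal lt_kn)) //= eqxx big1 ?addn0 // => y;
       rewrite -val_eqE => /negPf /= ->.
  by rewrite big1 // => y _; rewrite ltn_eqF // (leq_trans _ le_nk).
have n0 : (0 < n)%N by apply: leq_ltn_trans lt_in.
have lt_n1 : (n.-1 < n)%N by rewrite prednK.
have succ : (\sum_(y < n) (x.+1 == y) = ~~ (x == n.-1 :> nat))%N.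
  rewrite (eq_bigr (fun y : 'I_n => (true && (y == x.+1 :> nat) : nat))) => [|y _].
    by rewrite sum1 /=; congr (nat_of_bool _); have := ltn_ord x; lia.
  by rewrite eq_sym.
have pred : (\sum_(y < n) (y.+1 == x) = ~~ (x == 0 :> nat))%N.
  case: x {succ} => [[|x] lt_xn] /=; first by rewrite big1.
  rewrite (eq_bigr (fun y : 'I_n => (true && (y == x :> nat) : nat))) => [|y _] //.
  by rewrite sum1 /= (ltn_trans (ltnSn x)).
rewrite !sum1 succ pred lt_in lt_jn n0 lt_n1 !andbT.
by case: (x == n.-1 :> nat); case: (x == 0%N :> nat); case: (_ == i); case: (_ == j).
Qed.

(** * Transfer to rational polynomials, with [u] the indeterminate in the fraction field *)

Local Notation tofrac := (@FracField.tofrac {poly rat}).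

Lemma tofrac_det_ihara n i j : (i < n)%N -> (j < n)%N ->
  tofrac (\det (ihara_mx (hgraph n i j))) = \det (hgraph_mx (tofrac 'X) n i j).
Proof.
move=> lt_in lt_jn; rewrite -det_map_mx; congr (\det _).
apply/matrixP => x y; rewrite !mxE adjn_hgraph deg_hgraph //.
by rewrite -[LHS]/(tofrac _) tofracD tofracB !tofracM tofracB !tofracMn !tofrac1 expr2.
Qed.

Lemma frac_X2_neq1 : 1 - tofrac 'X ^+ 2 != 0.
Proof.
rewrite -tofracXn -tofrac1 -tofracB tofrac_eq0 -oppr_eq0 opprB.
exact: monic_neq0 (monicXnsubC _ _).
Qed.

Definition dumbbell_poly (a b c : nat) : {poly rat} :=
  (1 - 'X^a) * (1 - 'X^b) * ((1 - 'X^a) * (1 - 'X^b) - 4 * 'X^(a + b + c + c)).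

Definition theta_poly (a b c : nat) : {poly rat} :=
  (1 - 'X^(a + b) - 'X^(a + c) - 'X^(b + c)) ^+ 2 - 4 * 'X^(a + b + c + (a + b + c)).

Lemma det_ihara_dumbbell a b c :
  (1 - 'X^2) * \det (ihara_mx (hgraph (a + c + b).+1 (a + c) a)) =
  dumbbell_poly a.+1 b.+1 c.
Proof.
apply/eqP; rewrite -tofrac_eq; apply/eqP; rewrite tofracM tofrac_det_ihara; try lia.
rewrite tofracB tofrac1 tofracXn det_hgraph_mx_dumbbell ?frac_X2_neq1 //.
rewrite /dumbbell_poly !(tofracM, tofracB, tofrac1, tofracXn, tofracMn).
by rewrite !exprD !exprS; ring.
Qed.

Lemma det_ihara_theta a b c :
  (1 - 'X^2) * \det (ihara_mx (hgraph (a + c + b).+1 a (a + c))) =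
  theta_poly a.+1 c b.+1.
Proof.
apply/eqP; rewrite -tofrac_eq; apply/eqP; rewrite tofracM tofrac_det_ihara; try lia.
rewrite tofracB tofrac1 tofracXn det_hgraph_mx_theta ?frac_X2_neq1 //.
rewrite /theta_poly !(tofracM, tofracB, tofrac1, tofracXn, tofracMn).
by rewrite !exprD !exprS; ring.
Qed.

(** * Recovering the lengths *)

(** Settles the exponent comparisons that [lia] can decide; the others are left for case
    analysis. *)
Ltac decide_eqn := repeat match goal with |- context [@eq_op _ ?k ?e] =>
  first [have -> : (k == e) = false by lia | have -> : (k == e) = true by lia] end.

Lemma coef_dumbbell_poly a b c k : (dumbbell_poly a b c)`_k =
  (k == 0)%N%:R - 2 * (k == a)%:R - 2 * (k == b)%:R
  + (k == a + a)%N%:R + (k == b + b)%N%:R + 4 * (k == a + b)%N%:R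
  - 2 * (k == a + a + b)%N%:R - 2 * (k == a + b + b)%N%:R
  + (k == a + a + b + b)%N%:R - 4 * (k == a + b + c + c)%N%:R
  + 4 * (k == a + a + b + c + c)%N%:R + 4 * (k == a + b + b + c + c)%N%:R
  - 4 * (k == a + a + b + b + c + c)%N%:R.
Proof.
have -> : dumbbell_poly a b c = 'X^0 - 'X^a *+ 2 - 'X^b *+ 2
    + 'X^(a + a) + 'X^(b + b) + 'X^(a + b) *+ 4
    - 'X^(a + a + b) *+ 2 - 'X^(a + b + b) *+ 2
    + 'X^(a + a + b + b) - 'X^(a + b + c + c) *+ 4
    + 'X^(a + a + b + c + c) *+ 4 + 'X^(a + b + b + c + c) *+ 4
    - 'X^(a + a + b + b + c + c) *+ 4.
  by rewrite /dumbbell_poly expr0 !exprD; ring.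
by rewrite !(coefD, coefN, coefMn, coefXn); ring.
Qed.

Lemma coef_theta_poly a b c k : (theta_poly a b c)`_k =
  (k == 0)%N%:R - 2 * (k == a + b)%N%:R - 2 * (k == a + c)%N%:R - 2 * (k == b + c)%N%:R
  + (k == a + b + (a + b))%N%:R + (k == a + c + (a + c))%N%:R
  + (k == b + c + (b + c))%N%:R + 2 * (k == a + b + (a + c))%N%:R
  + 2 * (k == a + b + (b + c))%N%:R + 2 * (k == a + c + (b + c))%N%:R
  - 4 * (k == a + b + c + (a + b + c))%N%:R.
Proof.
have -> : theta_poly a b c =
    'X^0 - 'X^(a + b) *+ 2 - 'X^(a + c) *+ 2 - 'X^(b + c) *+ 2
    + 'X^(a + b + (a + b)) + 'X^(a + c + (a + c)) + 'X^(b + c + (b + c))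
    + 'X^(a + b + (a + c)) *+ 2 + 'X^(a + b + (b + c)) *+ 2
    + 'X^(a + c + (b + c)) *+ 2 - 'X^(a + b + c + (a + b + c)) *+ 4.
  by rewrite /theta_poly expr0 !exprD; ring.
by rewrite !(coefD, coefN, coefMn, coefXn); ring.
Qed.

Lemma size_eq_coef (p : {poly rat}) d :
  p`_d != 0 -> (forall k, (d < k)%N -> p`_k = 0) -> size p = d.+1.
Proof.
move=> pd pk; apply/eqP; rewrite eqn_leq; apply/andP; split; first exact/leq_sizeP.
by rewrite ltnNge; apply: contra pd => sp; rewrite nth_default.
Qed.

Lemma size_dumbbell_poly a b c : (0 < a)%N -> (0 < b)%N ->
  size (dumbbell_poly a b c) = (a + b + c + (a + b + c)).+1.
Proof.
move=> a0 b0; apply: size_eq_coef => [|k lt_k]; rewrite coef_dumbbell_poly.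
  (* The leading coefficient is -4, or 1 - 4 = -3 when [c = 0]. *)
  by case: c => [|c]; decide_eqn; apply/eqP => /= E; lra.
by decide_eqn; rewrite /=; lra.
Qed.

Lemma size_theta_poly a b c : (0 < a)%N -> (0 < b)%N -> (0 < c)%N ->
  size (theta_poly a b c) = (a + b + c + (a + b + c)).+1.
Proof.
move=> a0 b0 c0; apply: size_eq_coef => [|k lt_k]; rewrite coef_theta_poly.
  by decide_eqn; apply/eqP => /= E; lra.
by decide_eqn; rewrite /=; lra.
Qed.

(** The lowest positive exponent is [a]. Once [a] is known, two different values of [b] give
    coefficients differing by 2 at the smaller one. The degree then yields [c]. *)
Lemma dumbbell_poly_inj a b c a' b' c' :
  (0 < a <= b)%N -> (0 < a' <= b')%N ->
  dumbbell_poly a b c = dumbbell_poly a' b' c' -> [/\ a = a', b = b' & c = c'].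
Proof.
have le_a u v w u' v' w' : (0 < u <= v)%N -> (0 < u' <= v')%N ->
    dumbbell_poly u v w = dumbbell_poly u' v' w' -> (u' <= u)%N.
  move=> Hu Hu' /(congr1 (fun p : {poly rat} => p`_u)); rewrite leqNgt => E.
  apply/negP => lt_u; move: E; rewrite !coef_dumbbell_poly; decide_eqn.
  by case: (u == v) => /=; lra.
have le_b u v w v' w' : (0 < u <= v)%N -> (0 < u <= v')%N ->
    dumbbell_poly u v w = dumbbell_poly u v' w' -> (v' <= v)%N.
  move=> Hu Hu' /(congr1 (fun p : {poly rat} => p`_v)); rewrite leqNgt => E.
  apply/negP => lt_v; move: E; rewrite !coef_dumbbell_poly; decide_eqn.
  by case: (v == u); case: (v == u + u)%N => /=; lra.
move=> Ha Ha' E.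
have aa : a = a' by apply/eqP; rewrite eqn_leq (le_a _ _ _ _ _ _ Ha' Ha (esym E))
  (le_a _ _ _ _ _ _ Ha Ha' E).
subst a'.
have bb : b = b' by apply/eqP; rewrite eqn_leq (le_b _ _ _ _ _ Ha' Ha (esym E))
  (le_b _ _ _ _ _ Ha Ha' E).
subst b'; split=> //.
have := congr1 (fun p : {poly rat} => size p) E; rewrite !size_dumbbell_poly; lia.
Qed.

(** Equal degrees make the subtracted terms equal, so the squares agree, and the constant term 1
    fixes the sign of the root. The two smallest pair sums are then read off as exponents, and the
    total length does the rest. *)
Lemma theta_poly_inj a b c a' b' c' :
  (0 < a <= b)%N -> (b <= c)%N -> (0 < a' <= b')%N -> (b' <= c')%N ->
  theta_poly a b c = theta_poly a' b' c' -> [/\ a = a', b = b' & c = c'].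
Proof.
move=> Ha Hb Ha' Hb' E.
have sz : (a + b + c = a' + b' + c')%N.
  have := congr1 (fun p : {poly rat} => size p) E; rewrite !size_theta_poly; lia.
pose f u v w : {poly rat} := 1 - 'X^(u + v) - 'X^(u + w) - 'X^(v + w).
have coef_f u v w k : (f u v w)`_k =
    (k == 0)%N%:R - (k == u + v)%N%:R - (k == u + w)%N%:R - (k == v + w)%N%:R.
  by rewrite /f -[1](expr0 'X) !(coefD, coefN, coefXn).
have {}E : f a b c = f a' b' c'.
  move: E; rewrite /theta_poly -/(f a b c) -/(f a' b' c') sz => /addIr/eqP.
  rewrite eqf_sqr => /orP[/eqP //|/eqP/(congr1 (fun p : {poly rat} => p`_0))].
  by rewrite coefN !coef_f; decide_eqn => /= E; exfalso; move: E; clear; lra.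
have le_p u v w u' v' w' : (0 < u <= v)%N -> (v <= w)%N -> (0 < u' <= v')%N ->
    (v' <= w')%N -> f u v w = f u' v' w' -> (u' + v' <= u + v)%N.
  move=> H1 H2 H3 H4 /(congr1 (fun p : {poly rat} => p`_(u + v))).
  rewrite leqNgt => E'; apply/negP => lt_p; move: E'; rewrite !coef_f; decide_eqn.
  by case: (_ == _); case: (_ == _) => /=; lra.
have le_q u v w u' v' w' : (0 < u <= v)%N -> (v <= w)%N -> (0 < u' <= v')%N ->
    (v' <= w')%N -> (u + v = u' + v')%N -> f u v w = f u' v' w' -> (u' + w' <= u + w)%N.
  move=> H1 H2 H3 H4 H5 /(congr1 (fun p : {poly rat} => p`_(u + w))).
  rewrite leqNgt => E'; apply/negP => lt_p; move: E'; rewrite !coef_f -H5.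
  have -> : (u + w == 0)%N = false by lia.
  have -> : (u + w == u' + w')%N = false by lia.
  have -> : (u + w == v' + w')%N = false by lia.
  rewrite eqxx; clear.
  by case: (_ == _); case: (_ == _) => /=; lra.
have p_eq : (a + b = a' + b')%N.
  by apply/eqP; rewrite eqn_leq (le_p _ _ _ _ _ _ Ha' Hb' Ha Hb (esym E))
    (le_p _ _ _ _ _ _ Ha Hb Ha' Hb' E).
have q_eq : (a + c = a' + c')%N.
  by apply/eqP; rewrite eqn_leq (le_q _ _ _ _ _ _ Ha' Hb' Ha Hb (esym p_eq) (esym E))
    (le_q _ _ _ _ _ _ Ha Hb Ha' Hb' p_eq E).
by split; lia.
Qed.

(* With F = 1 - X^(a'+b') - X^(a'+c') - X^(b'+c') and H = (1 - X^a)(1 - X^b), equality would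
   make (F - H)(F + H) divisible by X^(a+b+2c); the factor F + H has constant
   term 2, but the coefficient of F - H at a + b is nonzero.  For c = 0 the
   leading coefficients differ. *)
Lemma dumbbell_neq_theta_poly a b c a' b' c' :
  (0 < a)%N -> (0 < b)%N -> (0 < a')%N -> (0 < b')%N -> (0 < c')%N ->
  dumbbell_poly a b c <> theta_poly a' b' c'.
Proof.
move=> a0 b0 a'0 b'0 c'0 E.
have sz : (a + b + c = a' + b' + c')%N.
  have := congr1 (fun p : {poly rat} => size p) E.
  rewrite size_theta_poly // size_dumbbell_poly //; lia.
case: c sz E => [|c] sz E.
  have := congr1 (fun p : {poly rat} => p`_(a + b + (a + b))) E.
  by rewrite coef_dumbbell_poly coef_theta_poly; decide_eqn => /=; lra.
pose f : {poly rat} := 1 - 'X^(a' + b') - 'X^(a' + c') - 'X^(b' + c').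
pose h : {poly rat} := (1 - 'X^a) * (1 - 'X^b).
have coef_f k : f`_k = (k == 0)%N%:R - (k == a' + b')%N%:R - (k == a' + c')%N%:R
    - (k == b' + c')%N%:R.
  by rewrite /f -[1](expr0 'X) !(coefD, coefN, coefXn).
have coef_h k : h`_k = (k == 0)%N%:R - (k == a)%N%:R - (k == b)%N%:R + (k == a + b)%N%:R.
  have -> : h = 'X^0 - 'X^a - 'X^b + 'X^(a + b) by rewrite /h expr0 exprD; ring.
  by rewrite !(coefD, coefN, coefXn).
(* By [sz], the subtracted term of the theta polynomial has exponent [a + b] plus that of the
   right-hand power, which can thus be factored out. *)
have factor : (f - h) * (f + h) = (4 * ('X^(a + b) - h)) * 'X^(a + b + c.+1 + c.+1).
  have -> : (f - h) * (f + h) = f ^+ 2 - h ^+ 2 by ring.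
  have -> : f ^+ 2 = theta_poly a' b' c' + 4 * 'X^(a + b) * 'X^(a + b + c.+1 + c.+1).
    rewrite -mulrA -exprD /theta_poly -/f -sz.
    have -> : (a + b + c.+1 + (a + b + c.+1) = a + b + (a + b + c.+1 + c.+1))%N by lia.
    by ring.
  by rewrite -E /dumbbell_poly -/h; ring.
have /dvdpP[q Eq] : 'X^(a + b + c.+1 + c.+1) %| f - h.
  rewrite -(@Gauss_dvdpl _ (f - h) (f + h)); first by rewrite factor dvdp_mulIr.
  apply/coprimep_expl; rewrite -['X]subr0 -polyC0 coprimep_sym coprimep_XsubC.
  rewrite rootE horner_coef0 coefD coef_f coef_h; decide_eqn.
  by apply/eqP => /=; clear; lra.
(* As [c.+1] is positive, a multiple of this power has coefficient 0 at [a + b], whereas [f - h] has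
   at most -1 there. *)
have := congr1 (fun p : {poly rat} => p`_(a + b)) Eq.
rewrite coefMXn coefB coef_f coef_h ifT; last by lia.
have -> : (a + b == 0)%N = false by lia.
have -> : (a + b == a)%N = false by lia.
have -> : (a + b == b)%N = false by lia.
rewrite eqxx; clear.
by case: (_ == _); case: (_ == _); case: (_ == _) => /=; lra.
Qed.

(** * Classification by lengths *)

(* Two cycles of lengths a and b joined by a path of length c (sharing a vertex if c = 0). *)
Definition dumbbell_graph a b c : mgraph :=
  hgraph (a + b + c).-1 (a + c).-1 a.-1.

(* Two vertices joined by three disjoint paths of lengths a, b and c. *)
Definition theta_graph a b c : mgraph :=
  hgraph (a + b + c).-1 a.-1 (a + b).-1.

Lemma dumbbell_graphC a b c : (0 < a)%N -> (0 < b)%N ->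
  isomorphic (dumbbell_graph a b c) (dumbbell_graph b a c).
Proof.
move=> a0 b0; rewrite /dumbbell_graph (addnC b a).
have -> : (b + c).-1 = ((a + b + c).-1.-1 - a.-1)%N by lia.
have -> : b.-1 = ((a + b + c).-1.-1 - (a + c).-1)%N by lia.
by apply: isomorphic_hgraph_rev; lia.
Qed.

Lemma theta_graph_rev a b c : (0 < a)%N -> (0 < b)%N -> (0 < c)%N ->
  isomorphic (theta_graph a b c) (theta_graph c b a).
Proof.
move=> a0 b0 c0; rewrite /theta_graph (_ : c + b + a = a + b + c)%N; last by lia.
have -> : c.-1 = ((a + b + c).-1.-1 - (a + b).-1)%N by lia.
have -> : (c + b).-1 = ((a + b + c).-1.-1 - a.-1)%N by lia.
by apply: isomorphic_hgraph_rev; lia.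
Qed.

(** Together with [theta_graph_rev] this generates all permutations of the three lengths. *)
Lemma theta_graph_swap a b c : (0 < a)%N -> (0 < b)%N -> (0 < c)%N ->
  isomorphic (theta_graph a b c) (theta_graph b a c).
Proof.
move=> a0 b0 c0; rewrite /theta_graph (addnC b a).
have -> : b.-1 = ((a + b).-1.-1 - a.-1)%N by lia.
by apply: isomorphic_hgraph_prefix; lia.
Qed.

Lemma det_dumbbell_graph a b c : (0 < a)%N -> (0 < b)%N ->
  (1 - 'X^2) * \det (ihara_mx (dumbbell_graph a b c)) = dumbbell_poly a b c.
Proof.
case: a b => [|a] [|b] // _ _; rewrite -det_ihara_dumbbell /dumbbell_graph.
by rewrite (_ : (a.+1 + b.+1 + c).-1 = (a + c + b).+1)%N //; lia.
Qed.

Lemma det_theta_graph a b c : (0 < a)%N -> (0 < c)%N ->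
  (1 - 'X^2) * \det (ihara_mx (theta_graph a b c)) = theta_poly a b c.
Proof.
case: a c => [|a] [|c] // _ _; rewrite -det_ihara_theta /theta_graph.
by rewrite (_ : (a.+1 + b + c.+1).-1 = (a + b + c).+1)%N //; lia.
Qed.

(** Lengths are read off the chord positions and sorted by the symmetries, as the injectivity lemmas
    require. *)
Lemma rank2_classification G : connected G -> no_deg1 G -> rank G = 2 ->
  (exists a b c, (0 < a <= b)%N /\ isomorphic (dumbbell_graph a b c) G) \/
  (exists a b c, [/\ (0 < a <= b)%N, (b <= c)%N & isomorphic (theta_graph a b c) G]).
Proof.
move=> cG dG rG; have [i [j [lt_i lt_j iso]]] := rank2_hgraph cG dG rG.
have [le_ji | lt_ij] := leqP j i; [left | right].
  have {}iso : isomorphic (dumbbell_graph j.+1 (nv G - i) (i - j)) G.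
    rewrite /dumbbell_graph (_ : (j.+1 + (nv G - i) + (i - j)).-1 = nv G); last by lia.
    by rewrite (_ : (j.+1 + (i - j)).-1 = i) //; lia.
  have [le_ab | lt_ba] := leqP j.+1 (nv G - i)%N.
    by exists j.+1, (nv G - i)%N, (i - j)%N; split; first by lia.
  exists (nv G - i)%N, j.+1, (i - j)%N; split; first by lia.
  by apply: isomorphic_trans iso; apply: dumbbell_graphC; lia.
have iso_ij : isomorphic (theta_graph i.+1 (j - i) (nv G - j)) G.
  rewrite /theta_graph (_ : (i.+1 + (j - i) + (nv G - j)).-1 = nv G); last by lia.
  by rewrite (_ : (i.+1 + (j - i)).-1 = j) //; lia.
have : [/\ 0 < i.+1, 0 < j - i & 0 < nv G - j]%N by split; lia.
move: (i.+1) (j - i)%N (nv G - j)%N iso_ij => a b c; clear.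
have swap u v w : (0 < u)%N -> (0 < v)%N -> (0 < w)%N ->
    isomorphic (theta_graph u v w) G -> isomorphic (theta_graph v u w) G.
  by move=> *; apply: isomorphic_trans (theta_graph_swap _ _ _) _.
have rev u v w : (0 < u)%N -> (0 < v)%N -> (0 < w)%N ->
    isomorphic (theta_graph u v w) G -> isomorphic (theta_graph w v u) G.
  by move=> *; apply: isomorphic_trans (theta_graph_rev _ _ _) _.
move=> abc [a0 b0 c0].
have bac := swap a b c a0 b0 c0 abc; have cba := rev a b c a0 b0 c0 abc.
have cab := rev b a c b0 a0 c0 bac; have bca := swap c b a c0 b0 a0 cba.
have acb := rev b c a b0 c0 a0 bca.
(* Two of the eight sign patterns are cyclic and contradictory; the other six are the orderings. *)
have [ab|ba] := leqP a b; have [bc|cb] := leqP b c; have [ac|ca] := leqP a c; try lia.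
- by exists a, b, c; split; first lia.
- by exists a, c, b; split; first lia; first lia.
- by exists c, a, b; split; first lia; first lia.
- by exists b, a, c; split; first lia; first lia.
- by exists b, c, a; split; first lia; first lia.
- by exists c, b, a; split; first lia; first lia.
Qed.

(** In rank two the prefactor is the nonzero element [1 - 'X^2], the same for both graphs, so it
    cancels. *)
Lemma ihara_zeta_eqE G1 G2 : rank G1 = 2 -> rank G2 = 2 ->
  ihara_zeta G1 = ihara_zeta G2 <-> \det (ihara_mx G1) = \det (ihara_mx G2).
Proof.
rewrite /ihara_zeta /ihara_recip => -> ->; split=> [/invr_inj | -> //].
rewrite (_ : 2 - 1 = 1 :> int) // expr1z => /mulfI E; apply/eqP.
rewrite -tofrac_eq; apply/eqP/E.
by rewrite tofracB tofrac1 tofracXn frac_X2_neq1.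
Qed.

Theorem theorem3 (G1 G2 : mgraph) :
  connected G1 -> connected G2 -> no_deg1 G1 -> no_deg1 G2 ->
  rank G1 = 2 -> rank G2 = 2 ->
  (isomorphic G1 G2 <-> ihara_zeta G1 = ihara_zeta G2).
Proof.
move=> c1 c2 d1 d2 r1 r2; rewrite ihara_zeta_eqE //.
split=> [|detE]; first exact: det_ihara_isomorphic.
(* Restoring this factor turns both determinants into the explicit polynomials: equal types force
   equal lengths, mixed types are impossible. *)
have {}detE := congr1 ( *%R (1 - 'X^2)) detE.
case: (rank2_classification c1 d1 r1) => - [a [b [c H1]]];
  case: (rank2_classification c2 d2 r2) => - [a' [b' [c' H2]]].
- case: H1 H2 => [ab iso1] [ab' iso2]; move: detE.
  rewrite -(det_ihara_isomorphic iso1) -(det_ihara_isomorphic iso2).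
  rewrite !det_dumbbell_graph; try lia.
  case/dumbbell_poly_inj => // ? ? ?; subst a' b' c'.
  exact: isomorphic_trans (isomorphic_sym iso1) iso2.
- case: H1 H2 => [ab iso1] [ab' bc' iso2]; move: detE.
  rewrite -(det_ihara_isomorphic iso1) -(det_ihara_isomorphic iso2).
  rewrite det_dumbbell_graph ?det_theta_graph; try lia.
  by move/dumbbell_neq_theta_poly; case; lia.
- case: H1 H2 => [ab bc iso1] [ab' iso2]; move: detE.
  rewrite -(det_ihara_isomorphic iso1) -(det_ihara_isomorphic iso2).
  rewrite det_dumbbell_graph ?det_theta_graph; try lia.
  by move/esym/dumbbell_neq_theta_poly; case; lia.
- case: H1 H2 => [ab bc iso1] [ab' bc' iso2]; move: detE.
  rewrite -(det_ihara_isomorphic iso1) -(det_ihara_isomorphic iso2).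
  rewrite !det_theta_graph; try lia.
  case/theta_poly_inj => // ? ? ?; subst a' b' c'.
  exact: isomorphic_trans (isomorphic_sym iso1) iso2.
Qed.
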